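(* Let $K$ be an algebraically closed field and let $a(n)_{n\ge 0}$ be a C-finite sequence over $K$ of order $d\ge 1$. Then there exist sequences $c_1(m),\dots,c_d(m)$ (indexed by integers $m\ge 0$) such that for every integer $m\ge 0$ the sequence $n\mapsto a(nm)$ satisfies a recurrence of the form $$a(nm)=\sum_{k=1}^{d} c_k(m)\,a((n-k)m)\qquad (n\ge d),$$ and such that the following hold. (i) For each $1\le k\le d$, the sequence $c_k(m)$ is C-finite with respect to $m$ and has order at most $\binom{d}{k}$. (ii) The sequence $c_1(m)$ always satisfies the same recurrence as $a(n)$ itself, i.e. it is annihilated by the characteristic polynomial of $a(n)$. (iii) $c_d(m)=\omega^m$ for all $m$, where $\omega$ is $(-1)^d$ times the constant coefficient of the characteristic polynomial of $a(n)$.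
   Context: Let $N$ be the shift operator on sequences, $Na(n)=a(n+1)$. A polynomial $p(x)$ annihilates the sequence $a(n)_{n\ge0}$ if $p(N)a(n)=0$ for all $n\ge 0$. A sequence $a(n)_{n\ge 0}$ with values in $K$ is C-finite if some nonzero polynomial $p(x)\in K[x]$ annihilates it. The set of polynomials annihilating $a(n)$ is an ideal of $K[x]$; its monic generator is the characteristic polynomial of $a(n)$, and the degree of this generator is the order (or degree) of $a(n)$.
   Formalization: Part (iii) is corrected to c_d(m) = (-1)^{d+1} ω^m; as printed, c_d(m) = ω^m fails for even d in characteristic not 2 (Fibonacci: ω = -1, but the recurrence at m = 1 forces c_2(1) = 1). *)

(* Defs.v *)
From HB Require Import structures.
From mathcomp Require Import all_boot all_order all_algebra.

Set Implicit Arguments.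
Unset Strict Implicit.
Unset Printing Implicit Defensive.

Import GRing.Theory.
Local Open Scope ring_scope.

Definition shift (K : fieldType) (a : nat -> K) : nat -> K := fun n => a n.+1.

(* The operator p(N) applied to the sequence a, where N is the shift. *)
Definition shift_poly (K : fieldType) (p : {poly K}) (a : nat -> K) : nat -> K :=
  fun n => \sum_(i < size p) p`_i * iter i (@shift K) a n.

Definition annihilates (K : fieldType) (p : {poly K}) (a : nat -> K) : Prop :=
  forall n, shift_poly p a n = 0.

Definition Cfinite (K : fieldType) (a : nat -> K) : Prop :=
  exists2 p : {poly K}, p != 0 & annihilates p a.

(* chi is the monic generator of the ideal of annihilating polynomials; it is
   unique, and it exists exactly when a is C-finite (chi = 1 when a = 0). *)
Definition is_charpoly (K : fieldType) (a : nat -> K) (chi : {poly K}) : Prop :=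
  chi \is monic /\ forall q : {poly K}, annihilates q a <-> chi %| q.

Definition has_order (K : fieldType) (a : nat -> K) (d : nat) : Prop :=
  exists2 chi : {poly K}, is_charpoly a chi & size chi = d.+1.

(* Main.v *)
Require Import Defs.
From HB Require Import structures.
From mathcomp Require Import all_boot all_order all_algebra.
From Stdlib Require Import Classical.

Set Implicit Arguments.
Unset Strict Implicit.
Unset Printing Implicit Defensive.

Import GRing.Theory.
Local Open Scope ring_scope.

(** If the characteristic polynomial factors as [\prod_i ('X - l i)], then
    [\prod_i ('X^m - l i ^+ m)] is a multiple of it, hence annihilates [a]; read
    as a polynomial in ['X^m], it is the desired recurrence.  So [c k m] is, up
    to sign, the [k]-th elementary symmetric function of the [l i ^+ m], i.e. a
    linear combination of the geometric sequences with ratios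
    [\prod_(i in S) l i], [#|S| = k].  Repeated or zero roots need no special
    treatment. *)

Section ShiftPoly.
Variables (K : fieldType) (a : nat -> K).
Implicit Types p q : {poly K}.

Lemma iter_shift i n : iter i (@shift K) a n = a (n + i)%N.
Proof.
by elim: i n => [|i IH] n /=; rewrite ?addn0 // /shift IH addSnnS.
Qed.

(** Padding with zero coefficients up to any [N] lets polynomials of different sizes share one
    summation range. *)
Lemma shift_polyE N p n :
  (size p <= N)%N -> shift_poly p a n = \sum_(i < N) p`_i * a (n + i)%N.
Proof.
move=> le_p_N; rewrite /shift_poly.
rewrite (big_ord_widen N (fun i => p`_i * iter i (@shift K) a n) le_p_N).
rewrite big_mkcond /=.
apply: eq_bigr => i _; rewrite iter_shift; case: ltnP => // le_p_i.
by rewrite nth_default ?mul0r.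
Qed.

Lemma shift_polyD p q n :
  shift_poly (p + q) a n = shift_poly p a n + shift_poly q a n.
Proof.
pose N := maxn (size (p + q)) (maxn (size p) (size q)).
rewrite !(@shift_polyE N) /N ?leq_max ?leqnn ?orbT // -big_split /=.
by apply: eq_bigr => i _; rewrite coefD mulrDl.
Qed.

Lemma shift_polyZ c p n : shift_poly (c *: p) a n = c * shift_poly p a n.
Proof.
rewrite !(@shift_polyE (size p)) ?size_scale_leq // mulr_sumr.
by apply: eq_bigr => i _; rewrite coefZ mulrA.
Qed.

Lemma annihilates0 : annihilates 0 a.
Proof. by move=> n; rewrite /shift_poly size_poly0 big_ord0. Qed.

Lemma shift_poly_sum I (r : seq I) (P : pred I) (F : I -> {poly K}) n :
  shift_poly (\sum_(i <- r | P i) F i) a n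
  = \sum_(i <- r | P i) shift_poly (F i) a n.
Proof.
exact: (big_morph (fun p => shift_poly p a n)
  (fun p q => shift_polyD p q n) (annihilates0 n)).
Qed.

Lemma shift_polyXn j n : shift_poly 'X^j a n = a (n + j)%N.
Proof.
rewrite (@shift_polyE j.+1) ?size_polyXn // (bigD1 ord_max) //= coefXn eqxx.
rewrite mul1r big1 ?addr0 // => i ne_i_j; rewrite coefXn.
by rewrite -(inj_eq val_inj) /= in ne_i_j; rewrite (negPf ne_i_j) mul0r.
Qed.

Lemma shift_polyMXn p j n : shift_poly (p * 'X^j) a n = shift_poly p a (n + j).
Proof.
rewrite [RHS](shift_polyE _ (leqnn _)) -{1}(coefK p) poly_def mulr_suml.
rewrite shift_poly_sum; apply: eq_bigr => i _.
by rewrite -scalerAl shift_polyZ -exprD shift_polyXn addnAC addnA.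
Qed.

(** This is how a polynomial in ['X^m] becomes a recurrence along the progression of step [m]. *)
Lemma shift_poly_compXn p m n :
  shift_poly (p \Po 'X^m) a n = \sum_(i < size p) p`_i * a (n + i * m)%N.
Proof.
rewrite comp_polyE shift_poly_sum; apply: eq_bigr => i _.
by rewrite shift_polyZ -exprM shift_polyXn mulnC.
Qed.

Lemma annihilatesD p q :
  annihilates p a -> annihilates q a -> annihilates (p + q) a.
Proof. by move=> pa qa n; rewrite shift_polyD pa qa addr0. Qed.

Lemma annihilatesMl q p : annihilates p a -> annihilates (q * p) a.
Proof.
move=> pa n; rewrite -(coefK q) poly_def mulr_suml shift_poly_sum big1 // => i _.
by rewrite -scalerAl shift_polyZ mulrC (mulrC 'X^i) shift_polyMXn pa mul0r.
Qed.

Lemma annihilates_dvdp p q : p %| q -> annihilates p a -> annihilates q a.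
Proof. by move=> /divpK <-; apply: annihilatesMl. Qed.

Lemma annihilates_modp p q :
  annihilates p a -> annihilates q a -> annihilates (q %% p) a.
Proof.
move=> pa qa; have -> : q %% p = - (q %/ p) * p + q.
  by rewrite {3}(divp_eq q p) mulNr addKr.
by apply: annihilatesD qa; apply: annihilatesMl.
Qed.

(** A nonzero annihilator of least degree, made monic, generates the ideal: the remainder of any
    other annihilator modulo it is a smaller annihilator, hence zero. *)
Lemma annihilates_has_order q :
  q != 0 -> annihilates q a ->
  exists2 e, has_order a e & (e < size q)%N.
Proof.
elim: (size q).+1 {-2}q (ltnSn (size q)) => // N IH {}q.
rewrite ltnS => le_q_N q0 qa.
(* Annihilation quantifies over all [n], so excluded middle decides whether a smaller annihilator
   exists; if so, descend to it. *)
have [[r [r0 ra lt_r_q]]|minq] := classic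
    (exists r, [/\ r != 0, annihilates r a & (size r < size q)%N]).
  have [e oe lt_e_r] := IH _ (leq_trans lt_r_q le_q_N) r0 ra.
  by exists e => //; apply: ltn_trans lt_r_q.
have [s0 sq] : (size q).-1.+1 = size q /\ lead_coef q != 0.
  by rewrite lead_coef_eq0 prednK // lt0n size_poly_eq0.
exists (size q).-1; last by rewrite s0.
exists ((lead_coef q)^-1 *: q); last by rewrite size_scale ?invr_eq0.
split; first by rewrite monicE lead_coefZ mulVf.
move=> p; rewrite dvdpZl ?invr_eq0 //; split => [pa|q_p].
  apply: NNPP => /negP q_ndvd_p; apply: minq; exists (p %% q).
  by rewrite ltn_modp q0; split=> //; apply: annihilates_modp.
exact: annihilates_dvdp q_p qa.
Qed.

End ShiftPoly.

(** A geometric sequence of ratio [mu i] is an eigenvector of the shift, so [p] acts on it as the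
    scalar [p.[mu i]]. *)
Lemma shift_poly_geometric (K : fieldType) (I : finType) (P : pred I)
    (w mu : I -> K) (p : {poly K}) n :
  shift_poly p (fun m => \sum_(i | P i) w i * mu i ^+ m) n
  = \sum_(i | P i) w i * mu i ^+ n * p.[mu i].
Proof.
rewrite (shift_polyE _ _ (leqnn _)).
under eq_bigr do rewrite mulr_sumr.
rewrite exchange_big /=; apply: eq_bigr => i _.
rewrite horner_coef mulr_sumr; apply: eq_bigr => j _.
by rewrite exprD mulrCA -[RHS]mulrA; congr (_ * _); rewrite mulrCA.
Qed.

Lemma annihilates_geometric (K : fieldType) (I : finType) (P : pred I)
    (w mu : I -> K) (p : {poly K}) :
  (forall i, P i -> root p (mu i)) ->
  annihilates p (fun m => \sum_(i | P i) w i * mu i ^+ m).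
Proof.
move=> rp n; rewrite shift_poly_geometric big1 // => i /rp/rootP ->.
by rewrite mulr0.
Qed.

(** Vieta's formula: in the expanded product, [S] is the set of factors contributing their constant
    term. *)
Lemma coef_prod_XsubC (R : comNzRingType) (I : finType) (x : I -> R) k :
  (k <= #|I|)%N ->
  (\prod_i ('X - (x i)%:P))`_(#|I| - k)
  = (-1) ^+ k * \sum_(S : {set I} | #|S| == k) \prod_(i in S) x i.
Proof.
move=> le_k; under eq_bigr do rewrite addrC -polyCN.
rewrite (bigA_distr _ _ (fun i => (- x i)%:P) (fun=> 'X)) coef_sum mulr_sumr.
rewrite [RHS]big_mkcond; apply: eq_bigr => S _.
have -> : \prod_i (if i \in S then (- x i)%:P else 'X)
       = ((-1) ^+ #|S| * \prod_(i in S) x i) *: 'X^(#|I| - #|S|).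
  rewrite -prodrN -mul_polyC rmorph_prod /= (bigID (mem S)) /=.
  congr (_ * _); first by apply: eq_bigr => i ->.
  rewrite (eq_bigr (fun=> 'X)) => [|i /negPf -> //].
  by rewrite prodr_const -(cardC (mem S)) addKn.
rewrite coefZ coefXn; have leS : (#|S| <= #|I|)%N := max_card _.
have [->|neS] := eqVneq #|S| k; first by rewrite eqxx mulr1.
case: eqP => [|_]; last by rewrite mulr0.
by move=> e; case/eqP: neS; rewrite -(subKn leS) -e subKn.
Qed.

(** Divisibility is checked factor by factor, so multiplicities need no counting. *)
Lemma dvdp_prod_XsubC_compXn (K : fieldType) (I : finType) (x : I -> K) m :
  \prod_i ('X - (x i)%:P) %| (\prod_i ('X - (x i ^+ m)%:P)) \Po 'X^m.
Proof.
rewrite rmorph_prod /=; apply: (big_ind2 (fun p q : {poly K} => p %| q)) => //.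
  by move=> *; apply: dvdp_mul.
move=> i _; rewrite dvdp_XsubCl; apply/rootP.
by rewrite horner_comp hornerXsubC hornerXn subrr.
Qed.

Theorem proposition1 (K : closedFieldType) (a : nat -> K) (d : nat)
  (chi : {poly K}) (ha : Cfinite a) (hd : (1 <= d)%N) (hord : has_order a d)
  (hchi : is_charpoly a chi) :
  exists c : nat -> nat -> K,
    [/\ forall m n : nat, (d <= n)%N ->
          a (n * m)%N = \sum_(1 <= k < d.+1) c k m * a ((n - k) * m)%N,
        forall k : nat, (1 <= k <= d)%N ->
          Cfinite (c k) /\
          exists2 e : nat, has_order (c k) e & (e <= 'C(d, k))%N,
        annihilates chi (c 1%N)
      & forall m : nat,
          c d m = (-1) ^+ d.+1 * ((-1) ^+ d * chi`_0) ^+ m].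
Proof.
have [chi_monic chiP] := hchi.
(* Two generators of the same ideal divide each other. *)
have size_chi : size chi = d.+1.
  have [chi' [chi'_monic chi'P] <-] := hord; apply: eqp_size.
  apply/andP; split.
    by apply/chiP/chi'P.
  by apply/chi'P/chiP.
have [l chiE] : exists l : 'I_d -> K, chi = \prod_i ('X - (l i)%:P).
  have [r] := closed_field_poly_normal chi.
  rewrite (monicP chi_monic) scale1r => chiE.
  have /eqP size_r : size r == d by rewrite -eqSS -size_chi chiE size_prod_XsubC.
  exists (fun i => r`_i).
  by rewrite chiE (big_nth 0) size_r big_mkord.
pose mu (S : {set 'I_d}) := \prod_(i in S) l i.
(* Vieta gives the sign [(-1) ^+ k]; moving the term across the recurrence adds one more factor
   [-1]. *)
pose c k m := \sum_(S : {set 'I_d} | #|S| == k) (-1) ^+ k.+1 * mu S ^+ m.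
pose P m := \prod_i ('X - (l i ^+ m)%:P).
have coefP k m : (k <= d)%N -> (P m)`_(d - k) = - c k m.
  move=> le_k; rewrite -[X in (X - k)%N]card_ord coef_prod_XsubC ?card_ord //.
  rewrite -sumrN mulr_sumr; apply: eq_bigr => S _.
  by rewrite exprS mulN1r mulNr opprK prodrXl.
have size_P m : size (P m) = d.+1.
  by rewrite size_prod_XsubC /index_enum -enumT size_enum_ord.
exists c; split.
- move=> m n le_d_n.
  (* Started at [(n - d) * m], the recurrence ends at [n * m]; reversing the sum puts that term
     first, with coefficient 1. *)
  have /(_ ((n - d) * m)%N) : annihilates (P m \Po 'X^m) a.
    by apply/chiP; rewrite chiE; apply: dvdp_prod_XsubC_compXn.
  rewrite shift_poly_compXn size_P -(big_mkord xpredT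
    (fun i => (P m)`_i * a ((n - d) * m + i * m)%N)) big_nat_rev /= add0n.
  rewrite big_nat_recl // subn1 /= -mulnDl subnK //.
  have -> : (P m)`_d = 1.
    have /monicP : P m \is monic by apply: monic_prod_XsubC.
    by rewrite lead_coefE size_P.
  rewrite mul1r => /eqP; rewrite addr_eq0 => /eqP ->.
  rewrite big_add1 /= -sumrN !big_nat; apply: eq_bigr => k /= lt_k_d.
  rewrite subSS coefP // mulNr opprK -mulnDl.
  by congr (_ * a (_ * m)%N); rewrite -[in RHS](subnK le_d_n) addnBA.
- move=> k /andP[_ le_k_d].
  (* One linear factor per [k]-subset gives degree ['C(d, k)]; coinciding ratios do no harm, as only
     an upper bound is claimed. *)
  pose q : {poly K} := \prod_(S : {set 'I_d} | #|S| == k) ('X - (mu S)%:P).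
  have q0 : q != 0 by apply/monic_neq0/monic_prod_XsubC.
  have qc : annihilates q (c k).
    apply: annihilates_geometric => S Sk.
    by rewrite /q (bigD1 S) //= rootM root_XsubC eqxx.
  split; first by exists q.
  have [e oe lt_e_q] := annihilates_has_order q0 qc; exists e => //.
  rewrite -ltnS (leq_trans lt_e_q) //.
  rewrite /q -big_enum size_prod_XsubC -cardE ltnS.
  rewrite -[X in 'C(X, _)](card_ord d) -card_draws.
  by rewrite subset_leq_card //; apply/subsetP=> S; rewrite !inE.
(* For [k = 1] the ratios are the roots [l i] of [chi] themselves. *)
- apply: annihilates_geometric => S /cards1P[i ->].
  by rewrite /mu big_set1 chiE (bigD1 i) //= rootM root_XsubC eqxx.
move=> m; rewrite /c (big_pred1 [set: 'I_d]) => [|S]; last first.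
  rewrite /= eqEcard subsetT cardsT card_ord eqn_leq.
  by rewrite -[X in (_ <= X)%N && _]card_ord max_card.
congr (_ * _ ^+ _); rewrite chiE -horner_coef0 horner_prod.
under [X in _ = _ * X]eq_bigr do rewrite hornerXsubC sub0r -mulN1r.
rewrite big_split /= prodr_const card_ord mulrA -exprMn mulrNN mul1r expr1n.
by rewrite mul1r /mu; apply: eq_bigl => i; rewrite inE.
Qed.
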